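(* Let $n\ge 1$, and let $(P,\mu^P),(Q,\mu^Q)\in\mathfrak{M}_n$ be weighted point clouds with $\ell_P$ and $\ell_Q$ points respectively. Then the following hold. 1. The optimization problem $$\min_{R}\min_{\sigma}\ \sum_{i,j}\sigma_{i,j}\,\|p_iR-q_j\|_2^2\quad\text{s.t.}\quad R\in O(n),\ \sigma\in \mathrm{ADM}(\mu^P,\mu^Q)$$ has at least one solution. 2. If $(P,\mu^P)\sim(P',\mu^{P'})$ and $(Q,\mu^Q)\sim(Q',\mu^{Q'})$ with $(P',\mu^{P'}),(Q',\mu^{Q'})\in\mathfrak{M}_n$, then $\mathrm{RWD}\big((P,\mu^P),(Q,\mu^Q)\big)=\mathrm{RWD}\big((P',\mu^{P'}),(Q',\mu^{Q'})\big)$. 3. $\mathrm{RWD}\big((P,\mu^P),(Q,\mu^Q)\big)\ge 0$, and $\mathrm{RWD}\big((P,\mu^P),(Q,\mu^Q)\big)=0$ if and only if $(P,\mu^P)\sim(Q,\mu^Q)$. 4. $\mathrm{RWD}\big((P,\mu^P),(Q,\mu^Q)\big)=\mathrm{RWD}\big((Q,\mu^Q),(P,\mu^P)\big)$. 5. For any $(S,\mu^S)\in\mathfrak{M}_n$, $\mathrm{RWD}\big((P,\mu^P),(Q,\mu^Q)\big)\le \mathrm{RWD}\big((P,\mu^P),(S,\mu^S)\big)+\mathrm{RWD}\big((S,\mu^S),(Q,\mu^Q)\big)$. Thus $\mathrm{RWD}(\cdot,\cdot)$ defines a distance (metric) on the quotient space $\mathfrak{M}_n/\sim$.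
   Context: Points of $\mathbb{R}^n$ are row vectors, and $O(n)=\{R\in\mathbb{R}^{n\times n}: RR^T=I_n\}$. The space of weighted point clouds is $$\mathfrak{M}_n=\bigcup_{\ell=1}^{\infty}\Big\{(P,\mu)=\{(p_i,\mu_i)\in\mathbb{R}^n\times\mathbb{R}_+\}_{i=1}^{\ell}\ :\ \sum_{i=1}^{\ell}\mu_i=1,\ p_i\ne p_j\text{ if }i\ne j\Big\},$$ where $\mathbb{R}_+$ denotes the strictly positive reals. For $(P,\mu^P),(Q,\mu^Q)\in\mathfrak{M}_n$ with $\ell_P,\ell_Q$ points, the set of admissible transport plans is $$\mathrm{ADM}(\mu^P,\mu^Q)=\Big\{\sigma=(\sigma_{i,j})\in\mathbb{R}^{\ell_P\times\ell_Q}: \sum_j\sigma_{i,j}=\mu^P_i,\ \sum_i\sigma_{i,j}=\mu^Q_j,\ \sigma_{i,j}\ge0\ \text{for all } i,j\Big\}.$$ The equivalence relation $(P,\mu^P)\sim(Q,\mu^Q)$ means: $\ell_P=\ell_Q$, and there exist $R\in O(n)$ and a permutation $\pi$ of $\{1,\dots,\ell_P\}$ such that $p_iR=q_{\pi(i)}$ and $\mu^P_i=\mu^Q_{\pi(i)}$ for all $i$. The robust Wasserstein distance $\mathrm{RWD}\ge 0$ is defined by $$\mathrm{RWD}\big((P,\mu^P),(Q,\mu^Q)\big)^2=\min_{R\in O(n),\ \sigma\in\mathrm{ADM}(\mu^P,\mu^Q)}\ \sum_{i,j}\sigma_{i,j}\,\|p_iR-q_j\|_2^2 .$$ *)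

(* Defs.v *)
From HB Require Import structures.
From mathcomp Require Import all_boot all_order all_algebra all_fingroup.
From mathcomp Require Import generic_quotient boolp classical_sets reals.

Set Implicit Arguments.
Unset Strict Implicit.
Unset Printing Implicit Defensive.

Import Order.TTheory GRing.Theory Num.Theory.

Local Open Scope classical_set_scope.
Local Open Scope ring_scope.

Record wcloud (R : realType) (n : nat) := WCloud {
  wsize : nat;
  wpoint : 'I_wsize -> 'rV[R]_n;
  wmass : 'I_wsize -> R;
  wsize_gt0 : (0 < wsize)%N;
  wmass_gt0 : forall i, 0 < wmass i;
  wmass_sum1 : \sum_i wmass i = 1;
  wpoint_inj : injective wpoint }.

Arguments wpoint {R n} w i.
Arguments wmass {R n} w i.

(* Mathcomp-analysis equips 'rV[R]_n with the sup norm, hence this definition. *)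
Definition norm2 (R : realType) (n : nat) (x : 'rV[R]_n) : R :=
  Num.sqrt (\sum_k x 0 k ^+ 2).

Definition orthogonal_group (R : realType) (n : nat) : set 'M[R]_n :=
  [set A | A *m A^T = 1%:M].

Arguments orthogonal_group : clear implicits.

Definition ADM (R : realType) (l m : nat) (mu : 'I_l -> R) (nu : 'I_m -> R) :
    set 'M[R]_(l, m) :=
  [set s | [/\ forall i, \sum_j s i j = mu i,
               forall j, \sum_i s i j = nu j &
               forall i j, 0 <= s i j]].

Arguments ADM {R l m} mu nu _.

Definition rw_cost (R : realType) (n : nat) (P Q : wcloud R n)
    (A : 'M[R]_n) (s : 'M[R]_(wsize P, wsize Q)) : R :=
  \sum_i \sum_j s i j * norm2 (wpoint P i *m A - wpoint Q j) ^+ 2.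

Definition rw_feasible (R : realType) (n : nat) (P Q : wcloud R n) :
    set ('M[R]_n * 'M[R]_(wsize P, wsize Q)) :=
  orthogonal_group R n `*` ADM (wmass P) (wmass Q).

Arguments rw_feasible {R n} P Q _.

Definition rw_solution (R : realType) (n : nat) (P Q : wcloud R n)
    (x : 'M[R]_n * 'M[R]_(wsize P, wsize Q)) : Prop :=
  rw_feasible P Q x /\
  forall y, rw_feasible P Q y -> rw_cost x.1 x.2 <= rw_cost y.1 y.2.

Arguments rw_solution {R n} P Q x.

(* The minimum is written as an infimum, with which it agrees as soon as the
   problem has a solution. *)
Definition RWD (R : realType) (n : nat) (P Q : wcloud R n) : R :=
  Num.sqrt (inf [set rw_cost x.1 x.2 | x in rw_feasible P Q]).

Definition wequiv (R : realType) (n : nat) (P Q : wcloud R n) : Prop :=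
  exists (e : wsize P = wsize Q) (A : 'M[R]_n) (pi : {perm 'I_(wsize P)}),
    orthogonal_group R n A /\
    forall i, wpoint P i *m A = wpoint Q (cast_ord e (pi i)) /\
              wmass P i = wmass Q (cast_ord e (pi i)).

Lemma wequiv_refl (R : realType) (n : nat) (P : wcloud R n) : wequiv P P.
Proof.
exists erefl, 1%:M, 1%g; split; first by rewrite /orthogonal_group /= trmx1 mulmx1.
by move=> i; rewrite mulmx1 perm1 cast_ord_id.
Qed.

Lemma wequiv_sym (R : realType) (n : nat) (P Q : wcloud R n) :
  wequiv P Q -> wequiv Q P.
Proof.
case: P => l p mu l0 mu0 mu1 pI; case: Q => l' q nu l'0 nu0 nu1 qI.
case=> /= e [A [pi [AO H]]]; subst l'.
exists erefl, A^T, (pi^-1)%g => /=; split.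
  by rewrite /orthogonal_group /= trmxK; exact: mulmx1C.
move=> i; have [] := H ((pi^-1)%g i); rewrite /= !cast_ord_id permKV => <- <-.
by rewrite -mulmxA AO mulmx1.
Qed.

Lemma wequiv_trans (R : realType) (n : nat) (P Q S : wcloud R n) :
  wequiv P Q -> wequiv Q S -> wequiv P S.
Proof.
case: P => l p mu l0 mu0 mu1 pI; case: Q => l' q nu l'0 nu0 nu1 qI.
case: S => l'' s xi l''0 xi0 xi1 sI.
case=> /= e [A [pi [AO H]]]; subst l'.
case=> /= e [B [rho [BO K]]]; subst l''.
exists erefl, (A *m B), (pi * rho)%g => /=; split.
  rewrite /orthogonal_group /= trmx_mul mulmxA -(mulmxA A) BO mulmx1.
  exact: AO.
move=> i; have [Hp Hm] := H i; have [Kp Km] := K (pi i).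
by move: Hp Hm Kp Km; rewrite /= !cast_ord_id permM mulmxA => -> -> -> ->.
Qed.

(* Classical eqType and choiceType structures: {eq_quot _} needs them. *)
HB.instance Definition _ (R : realType) (n : nat) := gen_eqMixin (wcloud R n).
HB.instance Definition _ (R : realType) (n : nat) :=
  gen_choiceMixin (wcloud R n).

Definition wequivb (R : realType) (n : nat) : rel (wcloud R n) :=
  fun P Q => `[< wequiv P Q >].

Lemma wequivb_equiv (R : realType) (n : nat) :
  equiv_class_of (@wequivb R n).
Proof.
split.
- by move=> P; apply/asboolP/wequiv_refl.
- by move=> P Q; apply/asboolP/asboolP; exact: wequiv_sym.
- move=> Q P S /asboolP PQ /asboolP QS; apply/asboolP.
  exact: wequiv_trans PQ QS.
Qed.

Canonical wequiv_rel (R : realType) (n : nat) : equiv_rel (wcloud R n) :=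
  EquivRelPack (wequivb_equiv R n).

Definition wcloud_quot (R : realType) (n : nat) :=
  {eq_quot (wequiv_rel R n)}%qT.

Definition is_distance (R : realType) (T : Type) (d : T -> T -> R) : Prop :=
  [/\ forall x y, 0 <= d x y,
      forall x y, d x y = 0 <-> x = y,
      forall x y, d x y = d y x &
      forall x y z, d x z <= d x y + d y z].

(* Main.v *)
Require Import Defs.
From mathcomp Require Import all_boot all_order all_algebra all_fingroup.
From mathcomp Require Import generic_quotient boolp classical_sets reals.
From mathcomp Require Import topology normedtype derive.
From mathcomp Require Import ring.

(** The minimum exists because the feasible set, a product of the orthogonal
    group and a transport polytope, is compact and the cost is a polynomial in
    the matrix entries ([rw_solution_exists]).  Hence the infimum in [RWD] is
    attained, and every inequality about [RWD] can be read on explicit feasible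
    pairs ([RWD_attained], [RWD_le]).

    Symmetry comes from transposing both the orthogonal matrix and the plan, since
    orthogonal matrices preserve the Euclidean norm.  For the triangle
    inequality, an optimal pair (A, s) from P to S and an optimal pair (B, t)
    from S to Q are composed: the matrix is AB, and the plan is the marginal
    on P x Q of the three-way coupling that glues s and t along S.  Since B is
    an isometry, |p A B - q| <= |p A - r| + |r B - q|, and Minkowski's inequality
    in L2 of the three-way coupling concludes ([RWD_triangle]).

    If the distance vanishes, an optimal plan only moves mass from p to q when
    p A = q.  The points of a cloud being distinct, such a plan is the graph of
    an injection, and so is its transpose: this is the bijection required by
    the equivalence relation ([RWD_eq0_wequiv]).

    Invariance under equivalence is then formal: it follows from the triangle
    inequality, because equivalent clouds are at distance zero ([RWD_wequiv]). *)

Set Implicit Arguments.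
Unset Strict Implicit.
Unset Printing Implicit Defensive.

Import Order.TTheory GRing.Theory Num.Theory.
Import numFieldNormedType.Exports.

Local Open Scope classical_set_scope.
Local Open Scope ring_scope.
Local Open Scope quotient_scope.

(** * Weighted Cauchy-Schwarz and Minkowski inequalities *)

(** With A and B the weighted square sums of a and b, and C that of their
    product, A (A B - C^2) is the weighted sum of the squares (A b - C a)^2,
    which settles the case A > 0.  When A = 0, every term w a vanishes. *)
Lemma weighted_cauchy_schwarz (R : realType) (I : finType) (w a b : I -> R) :
  (forall i, 0 <= w i) ->
  (\sum_i w i * (a i * b i)) ^+ 2 <=
  (\sum_i w i * a i ^+ 2) * (\sum_i w i * b i ^+ 2).
Proof.
move=> w_ge0.
have expand (x y : R) : \sum_i w i * (x * b i - y * a i) ^+ 2 =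
    x ^+ 2 * (\sum_i w i * b i ^+ 2) - 2 * x * y * (\sum_i w i * (a i * b i))
    + y ^+ 2 * (\sum_i w i * a i ^+ 2).
  rewrite !mulr_sumr -sumrB -big_split/=.
  by apply: eq_bigr => i _; ring.
set A := \sum_i w i * a i ^+ 2 in expand *.
set B := \sum_i w i * b i ^+ 2 in expand *.
set C := \sum_i w i * (a i * b i) in expand *.
have wa_ge0 i : 0 <= w i * a i ^+ 2 by rewrite mulr_ge0 ?sqr_ge0.
have [A0|A_neq0] := eqVneq A 0.
  have wa0 i : w i * a i = 0.
    have /eqP : w i * a i ^+ 2 = 0.
      by move/eqP: A0; rewrite psumr_eq0// => /allP/(_ i)/(_ (mem_index_enum _))/eqP.
    by rewrite mulf_eq0 expf_eq0/= -mulf_eq0 => /eqP.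
  rewrite A0 mul0r /C big1 ?expr0n// => i _.
  by rewrite mulrA wa0 mul0r.
have A_gt0 : 0 < A by rewrite lt0r A_neq0 sumr_ge0.
rewrite -subr_ge0 -(pmulr_rge0 _ A_gt0).
have -> : A * (A * B - C ^+ 2) = \sum_i w i * (A * b i - C * a i) ^+ 2.
  by rewrite expand; ring.
by apply: sumr_ge0 => i _; rewrite mulr_ge0 ?sqr_ge0.
Qed.

(** Unit weights give the Euclidean triangle inequality; the masses of a
    three-way coupling as weights give the one between weighted clouds. *)
Lemma weighted_minkowski (R : realType) (I : finType) (w a b : I -> R) :
  (forall i, 0 <= w i) ->
  Num.sqrt (\sum_i w i * (a i + b i) ^+ 2) <=
  Num.sqrt (\sum_i w i * a i ^+ 2) + Num.sqrt (\sum_i w i * b i ^+ 2).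
Proof.
move=> w_ge0; have sum_ge0 c : 0 <= \sum_i w i * c i ^+ 2.
  by apply: sumr_ge0 => i _; rewrite mulr_ge0 ?sqr_ge0.
rewrite -ler_sqr ?nnegrE ?addr_ge0 ?sqrtr_ge0// sqrrD !sqr_sqrtr//.
have -> : \sum_i w i * (a i + b i) ^+ 2 = \sum_i w i * a i ^+ 2 +
    (\sum_i w i * (a i * b i)) *+ 2 + \sum_i w i * b i ^+ 2.
  rewrite -mulr_natr mulr_suml -!big_split/=.
  by apply: eq_bigr => i _; ring.
rewrite lerD2r lerD2l lerMn2r/= -sqrtrM// (le_trans (ler_norm _))//.
by rewrite -sqrtr_sqr ler_wsqrtr// weighted_cauchy_schwarz.
Qed.

(** * The Euclidean norm and orthogonal matrices *)

Lemma norm2_ge0 (R : realType) (n : nat) (x : 'rV[R]_n) : 0 <= norm2 x.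
Proof. exact: sqrtr_ge0. Qed.

Lemma norm2_sqr (R : realType) (n : nat) (x : 'rV[R]_n) :
  norm2 x ^+ 2 = \sum_k x 0 k ^+ 2.
Proof. by rewrite sqr_sqrtr// sumr_ge0// => k _; rewrite sqr_ge0. Qed.

Lemma norm20 (R : realType) (n : nat) : norm2 (0 : 'rV[R]_n) = 0.
Proof. by rewrite /norm2 big1 ?sqrtr0// => k _; rewrite mxE expr0n. Qed.

Lemma norm2_sqr_eq0 (R : realType) (n : nat) (x : 'rV[R]_n) :
  norm2 x ^+ 2 = 0 -> x = 0.
Proof.
rewrite norm2_sqr => /eqP; rewrite psumr_eq0 => [/allP x0|k _]; last exact: sqr_ge0.
apply/rowP => k; apply/eqP; rewrite mxE.
by have := x0 k (mem_index_enum _); rewrite sqrf_eq0.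
Qed.

Lemma norm2N (R : realType) (n : nat) (x : 'rV[R]_n) : norm2 (- x) = norm2 x.
Proof.
by congr Num.sqrt; apply: eq_bigr => k _; rewrite mxE sqrrN.
Qed.

Lemma norm2D (R : realType) (n : nat) (x y : 'rV[R]_n) :
  norm2 (x + y) <= norm2 x + norm2 y.
Proof.
have norm2E (z : 'rV[R]_n) : norm2 z = Num.sqrt (\sum_k 1 * z 0 k ^+ 2).
  by congr Num.sqrt; apply: eq_bigr => k _; rewrite mul1r.
rewrite !norm2E; under eq_bigr do rewrite mxE.
exact: (@weighted_minkowski _ _ (fun=> 1)).
Qed.

Lemma orthogonal_mulmxT (R : realType) (n : nat) (A : 'M[R]_n) :
  orthogonal_group R n A -> A *m A^T = 1%:M.
Proof. by []. Qed.

Lemma norm2_mulmx_orthogonal (R : realType) (n : nat) (A : 'M[R]_n)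
    (x : 'rV[R]_n) : orthogonal_group R n A -> norm2 (x *m A) = norm2 x.
Proof.
have normE (y : 'rV[R]_n) : norm2 y = Num.sqrt ((y *m y^T) 0 0).
  by congr Num.sqrt; rewrite mxE; apply: eq_bigr => k _; rewrite mxE expr2.
move=> AO; rewrite !normE trmx_mul mulmxA -(mulmxA x).
by rewrite orthogonal_mulmxT ?mulmx1.
Qed.

Lemma orthogonal_groupT (R : realType) (n : nat) (A : 'M[R]_n) :
  orthogonal_group R n A -> orthogonal_group R n A^T.
Proof. by move=> AO; rewrite /orthogonal_group /= trmxK; exact: mulmx1C. Qed.

Lemma orthogonal_groupM (R : realType) (n : nat) (A B : 'M[R]_n) :
  orthogonal_group R n A -> orthogonal_group R n B ->
  orthogonal_group R n (A *m B).
Proof.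
move=> AO BO; rewrite /orthogonal_group /= trmx_mul mulmxA -(mulmxA A).
by rewrite (orthogonal_mulmxT BO) mulmx1; exact: AO.
Qed.

Lemma mulmx_orthogonal_inj (R : realType) (n : nat) (A : 'M[R]_n) :
  orthogonal_group R n A -> injective (fun x : 'rV[R]_n => x *m A).
Proof.
by move=> AO; apply: (can_inj (g := mulmx^~ A^T)) => x; rewrite -mulmxA orthogonal_mulmxT ?mulmx1.
Qed.

(** * Compactness of the feasible set *)

(** A neighbourhood of a matrix constrains finitely many entries. *)
Lemma continuous_matrix (R : realType) (T : topologicalType) (m n : nat)
    (f : T -> 'M[R]_(m, n)) :
  (forall i j, continuous (fun x => f x i j)) -> continuous f.
Proof.
move=> fc x; apply/cvg_ballP => e e0.
have : \forall y \near x, forall ij : 'I_m * 'I_n, ball (f x ij.1 ij.2) e (f y ij.1 ij.2).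
  apply: filter_forall => -[i j] /=.
  by have /cvg_ballP := fc i j x; exact.
by apply: filterS => y fy; split => // i j; exact: (fy (i, j)).
Qed.

(** Compactness of boxes of row vectors (Tychonoff) is carried over by the
    reshaping map, a continuous bijection between the two boxes. *)
Lemma compact_matrix_box (R : realType) (m n : nat) (a b : R) :
  compact [set M : 'M[R]_(m, n) | forall i j, a <= M i j <= b].
Proof.
pose box := [set v : 'rV[R]_(m * n) | forall k, `[a, b]%classic (v ord0 k)].
have boxc : compact box.
  by apply: (@rV_compact _ _ (fun=> `[a, b]%classic)) => _; exact: segment_compact.
have vecc : continuous (vec_mx : 'rV[R]_(m * n) -> 'M[R]_(m, n)).
  apply: continuous_matrix => i j.
  under eq_fun do rewrite mxE.
  exact: coord_continuous.
rewrite [X in compact X](_ : _ = vec_mx @` box).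
  by apply: continuous_compact => //; exact: continuous_subspaceT.
apply/seteqP; split => [M Mab|_ [v vab <-] i j]; last first.
  by rewrite mxE; have := vab (mxvec_index i j); rewrite /= in_itv.
exists (mxvec M); last exact: mxvecK.
by move=> k; case/mxvec_indexP: k => i j; rewrite mxvecE /= in_itv /= Mab.
Qed.

Lemma closed_eq_continuous (R : realType) (T : topologicalType) (f : T -> R) (c : R) :
  continuous f -> closed [set x | f x = c].
Proof.
by move=> fc; apply: (@preimage_closed _ _ f [set x | x = c]) => //; exact: closed_eq.
Qed.

Lemma closed_ge_continuous (R : realType) (T : topologicalType) (f : T -> R) (c : R) :
  continuous f -> closed [set x | c <= f x].
Proof.
by move=> fc; apply: (@preimage_closed _ _ f [set x | c <= x]) => //; exact: closed_ge.
Qed.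

Lemma continuous_sum (R : realType) (T : topologicalType) (I : finType) (f : I -> T -> R) :
  (forall i, continuous (f i)) -> continuous (fun x => \sum_i f i x).
Proof. move=> fc; apply: continuous_big => //; exact: add_continuous. Qed.

Lemma compact_orthogonal_group (R : realType) (n : nat) :
  compact (orthogonal_group R n).
Proof.
apply: (subclosed_compact _ (@compact_matrix_box R n n (-1) 1)).
  rewrite [X in closed X](_ : _ = \bigcap_(ij in [set: 'I_n * 'I_n])
     [set A : 'M[R]_n | \sum_k A ij.1 k * A ij.2 k = (ij.1 == ij.2)%:R]).
    apply: closed_bigI => -[i j] _ /=.
    apply: closed_eq_continuous; apply: continuous_sum => k A.
    by apply: continuousM; exact: coord_continuous.
  apply/seteqP; split => A /= AO.
    move=> -[i j] _ /=; have /matrixP/(_ i j) := AO; rewrite !mxE => <-.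
    by apply: eq_bigr => k _; rewrite mxE.
  apply/matrixP => i j; rewrite !mxE -(AO (i, j) Logic.I) /=.
  by apply: eq_bigr => k _; rewrite mxE.
(* A row of an orthogonal matrix has squared entries summing to one. *)
move=> A AO i j; rewrite -ler_norml -(@ler_sqr R) ?nnegrE// expr1n real_normK ?num_real//.
have /matrixP/(_ i i) := AO; rewrite !mxE eqxx mulr1n => <-.
rewrite (bigD1 j)//= mxE -expr2 lerDl sumr_ge0// => k _.
by rewrite mxE -expr2 sqr_ge0.
Qed.

Lemma compact_ADM (R : realType) (l m : nat) (mu : 'I_l -> R) (nu : 'I_m -> R) :
  compact (ADM mu nu).
Proof.
(* Any common upper bound of the row masses bounds the entries; this one is
   simple to write down for an arbitrary family. *)
pose b := \sum_i `|mu i|.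
apply: (subclosed_compact _ (@compact_matrix_box R l m 0 b)).
  rewrite [X in closed X](_ : _ =
     \bigcap_(i in [set: 'I_l]) [set s : 'M[R]_(l, m) | \sum_j s i j = mu i] `&`
     \bigcap_(j in [set: 'I_m]) [set s : 'M[R]_(l, m) | \sum_i s i j = nu j] `&`
     \bigcap_(ij in [set: 'I_l * 'I_m]) [set s : 'M[R]_(l, m) | 0 <= s ij.1 ij.2]).
    apply: closedI; first apply: closedI; apply: closed_bigI.
    - move=> i _; apply: closed_eq_continuous; apply: continuous_sum => j.
      exact: coord_continuous.
    - move=> j _; apply: closed_eq_continuous; apply: continuous_sum => i.
      exact: coord_continuous.
    - move=> ij _; apply: closed_ge_continuous; exact: coord_continuous.
  apply/seteqP; split => s /=.
    by move=> [smu snu s0]; split; [split|] => [i _|j _|ij _] /=.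
  by move=> [[smu snu] s0]; split => [i|j|i j]; [exact: smu|exact: snu|exact: (s0 (i, j))].
move=> s [smu _ s0] i j; rewrite s0/= (@le_trans _ _ (mu i))//.
  by rewrite -smu (bigD1 j)//= lerDl sumr_ge0.
rewrite (le_trans (ler_norm _))// /b (bigD1 i)//= lerDl.
by rewrite sumr_ge0// => k _; exact: normr_ge0.
Qed.

(** The norm only occurs squared, so the cost is a polynomial in the entries
    of the orthogonal matrix and of the plan. *)
Lemma continuous_rw_cost (R : realType) (n : nat) (P Q : wcloud R n) :
  continuous (fun x : 'M[R]_n * 'M[R]_(wsize P, wsize Q) => rw_cost x.1 x.2).
Proof.
pose T := ('M[R]_n * 'M[R]_(wsize P, wsize Q))%type.
have plan_entry i j : continuous (fun x : T => x.2 i j).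
  move=> x; apply: (@continuous_comp _ _ _ snd (fun s : 'M[R]_(_, _) => s i j)).
    exact: cvg_snd.
  exact: coord_continuous.
have rot_entry h k : continuous (fun x : T => x.1 h k).
  move=> x; apply: (@continuous_comp _ _ _ fst (fun A : 'M[R]_n => A h k)).
    exact: cvg_fst.
  exact: coord_continuous.
have diff_entry i j k :
    continuous (fun x : T => (wpoint P i *m x.1 - wpoint Q j) 0 k).
  under eq_fun do rewrite !mxE.
  move=> x; apply: continuousB; last exact: cst_continuous.
  move: x; apply: continuous_sum => h x.
  by apply: continuousM; [exact: cst_continuous|exact: rot_entry].
apply: continuous_sum => i; apply: continuous_sum => j.
under eq_fun do rewrite norm2_sqr.
move=> x; apply: continuousM; first exact: plan_entry.
move: x; apply: continuous_sum => k.
under eq_fun do rewrite expr2.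
by move=> x; apply: continuousM; exact: diff_entry.
Qed.

(** * Existence of an optimal pair *)

Lemma wmass_ge0 (R : realType) (n : nat) (P : wcloud R n) i : 0 <= wmass P i.
Proof. exact/ltW/wmass_gt0. Qed.

(** The independent coupling shows that transport plans exist at all. *)
Lemma product_plan_ADM (R : realType) (n : nat) (P Q : wcloud R n) :
  ADM (wmass P) (wmass Q) (\matrix_(i, j) (wmass P i * wmass Q j)).
Proof.
split => [i|j|i j]; last by rewrite mxE mulr_ge0// wmass_ge0.
- by under eq_bigr do rewrite mxE; rewrite -mulr_sumr wmass_sum1 mulr1.
- by under eq_bigr do rewrite mxE; rewrite -mulr_suml wmass_sum1 mul1r.
Qed.

Lemma rw_solution_exists (R : realType) (n : nat) (P Q : wcloud R n) :
  exists x, rw_solution P Q x.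
Proof.
have feasible0 : rw_feasible P Q !=set0.
  exists (1%:M, \matrix_(i, j) (wmass P i * wmass Q j)); split => /=.
    by rewrite /orthogonal_group /= trmx1 mulmx1.
  exact: product_plan_ADM.
have [||x xF xmin] := compact_EVT_min feasible0 _ (f := fun x => rw_cost x.1 x.2).
- by apply: compact_setX; [exact: compact_orthogonal_group|exact: compact_ADM].
- exact/continuous_subspaceT/continuous_rw_cost.
exists x; split=> [|y yF]; first by rewrite inE in xF.
by apply: xmin; rewrite inE.
Qed.

Lemma rw_cost_ge0 (R : realType) (n : nat) (P Q : wcloud R n) x :
  rw_feasible P Q x -> 0 <= rw_cost x.1 x.2.
Proof.
move=> [_ [_ _ s0]]; do 2 (apply: sumr_ge0 => ? _).
by rewrite mulr_ge0 ?sqr_ge0.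
Qed.

Lemma RWD_solution (R : realType) (n : nat) (P Q : wcloud R n) x :
  rw_solution P Q x -> RWD P Q = Num.sqrt (rw_cost x.1 x.2).
Proof.
move=> [xF xmin]; congr Num.sqrt; apply/eqP; rewrite eq_le; apply/andP; split.
  by apply: ge_inf; [exists (rw_cost x.1 x.2) => _ [y yF <-]; exact: xmin|exists x].
apply: lb_le_inf; first by exists (rw_cost x.1 x.2), x.
by move=> _ [y yF <-]; exact: xmin.
Qed.

Lemma RWD_attained (R : realType) (n : nat) (P Q : wcloud R n) :
  exists2 x, rw_feasible P Q x & RWD P Q = Num.sqrt (rw_cost x.1 x.2).
Proof.
have [x xsol] := rw_solution_exists P Q.
by exists x; [exact: xsol.1|exact: RWD_solution].
Qed.

Lemma RWD_le (R : realType) (n : nat) (P Q : wcloud R n) x :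
  rw_feasible P Q x -> RWD P Q <= Num.sqrt (rw_cost x.1 x.2).
Proof.
move=> xF; have [y ysol] := rw_solution_exists P Q.
by rewrite (RWD_solution ysol) ler_wsqrtr// ysol.2.
Qed.

Lemma RWD_ge0 (R : realType) (n : nat) (P Q : wcloud R n) : 0 <= RWD P Q.
Proof. exact: sqrtr_ge0. Qed.

(** * Symmetry *)

Lemma rw_feasibleT (R : realType) (n : nat) (P Q : wcloud R n) x :
  rw_feasible P Q x -> rw_feasible Q P (x.1^T, x.2^T).
Proof.
move=> [AO [sP sQ s0]]; split=> /=; first exact: orthogonal_groupT.
by split=> [j|i|j i]; rewrite ?mxE// -?sP -?sQ; apply: eq_bigr => k _; rewrite mxE.
Qed.

(** Applying the isometry A to q A^T - p turns it into q - p A. *)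
Lemma rw_costT (R : realType) (n : nat) (P Q : wcloud R n) (A : 'M[R]_n)
    (s : 'M[R]_(wsize P, wsize Q)) :
  orthogonal_group R n A -> rw_cost (P := Q) (Q := P) A^T s^T = rw_cost A s.
Proof.
move=> AO; rewrite /rw_cost exchange_big /=.
apply: eq_bigr => i _; apply: eq_bigr => j _; rewrite mxE; congr (_ * _ ^+ 2).
rewrite -(norm2_mulmx_orthogonal _ AO) mulmxBl -mulmxA.
by rewrite (mulmx1C (orthogonal_mulmxT AO)) mulmx1 -norm2N opprB.
Qed.

Lemma RWD_sym (R : realType) (n : nat) (P Q : wcloud R n) : RWD P Q = RWD Q P.
Proof.
suff le (P' Q' : wcloud R n) : RWD P' Q' <= RWD Q' P'.
  by apply/eqP; rewrite eq_le !le.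
have [x xF ->] := RWD_attained Q' P'.
by rewrite -(rw_costT x.2 xF.1); exact: RWD_le (rw_feasibleT xF).
Qed.

(** * The triangle inequality *)

(** The gluing of two plans along the middle cloud: given the middle point k,
    the two outer points i and j are drawn independently.  Its two-dimensional
    marginals are s and t. *)
Definition glue (R : realType) (n : nat) (P S Q : wcloud R n)
    (s : 'M[R]_(wsize P, wsize S)) (t : 'M[R]_(wsize S, wsize Q)) i k j : R :=
  s i k * t k j / wmass S k.

Lemma glue_ge0 (R : realType) (n : nat) (P S Q : wcloud R n)
    (s : 'M[R]_(wsize P, wsize S)) (t : 'M[R]_(wsize S, wsize Q)) i k j :
  ADM (wmass P) (wmass S) s -> ADM (wmass S) (wmass Q) t -> 0 <= glue s t i k j.
Proof. by move=> [_ _ s0] [_ _ t0]; rewrite divr_ge0 ?mulr_ge0// wmass_ge0. Qed.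

Lemma sum_glue_last (R : realType) (n : nat) (P S Q : wcloud R n)
    (s : 'M[R]_(wsize P, wsize S)) (t : 'M[R]_(wsize S, wsize Q)) i k :
  ADM (wmass S) (wmass Q) t -> \sum_j glue s t i k j = s i k.
Proof.
move=> [tS _ _]; rewrite -mulr_suml -mulr_sumr tS mulfK//.
by rewrite gt_eqF// wmass_gt0.
Qed.

Lemma sum_glue_first (R : realType) (n : nat) (P S Q : wcloud R n)
    (s : 'M[R]_(wsize P, wsize S)) (t : 'M[R]_(wsize S, wsize Q)) k j :
  ADM (wmass P) (wmass S) s -> \sum_i glue s t i k j = t k j.
Proof.
move=> [_ sS _]; rewrite -mulr_suml -mulr_suml sS mulrAC divff ?mul1r//.
by rewrite gt_eqF// wmass_gt0.
Qed.

(** Forgetting the middle point of the glued coupling leaves a plan between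
    the outer clouds: each of its marginals is computed by first summing to s
    or to t. *)
Lemma glue_ADM (R : realType) (n : nat) (P S Q : wcloud R n)
    (s : 'M[R]_(wsize P, wsize S)) (t : 'M[R]_(wsize S, wsize Q)) :
  ADM (wmass P) (wmass S) s -> ADM (wmass S) (wmass Q) t ->
  ADM (wmass P) (wmass Q) (\matrix_(i, j) \sum_k glue s t i k j).
Proof.
move=> sF tF; split=> [i|j|i j].
- under eq_bigr do rewrite mxE.
  rewrite exchange_big/= -(let: And3 sP _ _ := sF in sP i).
  by apply: eq_bigr => k _; exact: sum_glue_last.
- under eq_bigr do rewrite mxE.
  rewrite exchange_big/= -(let: And3 _ tQ _ := tF in tQ j).
  by apply: eq_bigr => k _; exact: sum_glue_first.
- by rewrite mxE; apply: sumr_ge0 => k _; exact: glue_ge0.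
Qed.

(** The three square roots are L2 norms for the glued coupling: those of a and
    b recover the two given costs by marginalization, while the square of that
    of a + b dominates the cost of the composed pair, term by term. *)
Lemma RWD_triangle (R : realType) (n : nat) (P Q S : wcloud R n) :
  RWD P Q <= RWD P S + RWD S Q.
Proof.
have [[A s] /= [AO sF] ->] := RWD_attained P S.
have [[B t] /= [BO tF] ->] := RWD_attained S Q.
rewrite /= in AO sF BO tF.
pose I := ('I_(wsize P) * 'I_(wsize S) * 'I_(wsize Q))%type.
pose w (x : I) := glue s t x.1.1 x.1.2 x.2.
pose a (x : I) := norm2 (wpoint P x.1.1 *m A - wpoint S x.1.2).
pose b (x : I) := norm2 (wpoint S x.1.2 *m B - wpoint Q x.2).
have w_ge0 x : 0 <= w x by exact: glue_ge0.
have sumI (F : I -> R) : \sum_x F x = \sum_i \sum_k \sum_j F (i, k, j).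
  by rewrite !pair_big /=; apply: eq_bigr => -[[]].
pose u := \matrix_(i, j) \sum_k glue s t i k j : 'M_(wsize P, wsize Q).
have ABF : rw_feasible P Q (A *m B, u).
  by split=> /=; [exact: orthogonal_groupM|exact: glue_ADM].
have costPS : rw_cost A s = \sum_x w x * a x ^+ 2.
  rewrite sumI; apply: eq_bigr => i _; apply: eq_bigr => k _.
  by rewrite /w /a /= -mulr_suml sum_glue_last.
have costSQ : rw_cost B t = \sum_x w x * b x ^+ 2.
  rewrite sumI exchange_big; apply: eq_bigr => k _; rewrite exchange_big.
  apply: eq_bigr => j _.
  by rewrite /w /b /= -mulr_suml sum_glue_first.
have costPQ : rw_cost (A *m B) u <= \sum_x w x * (a x + b x) ^+ 2.
  rewrite sumI; apply: ler_sum => i _; rewrite exchange_big; apply: ler_sum => j _.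
  rewrite mxE mulr_suml; apply: ler_sum => k _.
  apply: ler_wpM2l; first exact: (w_ge0 (i, k, j)).
  rewrite ler_sqr ?nnegrE ?addr_ge0 ?norm2_ge0//= /a /b /=.
  rewrite -(norm2_mulmx_orthogonal (_ - wpoint S k) BO) mulmxBl.
  by rewrite (le_trans _ (norm2D _ _))// mulmxA addrA subrK.
apply: (le_trans (RWD_le ABF)); rewrite costPS costSQ /=.
by rewrite (le_trans (ler_wsqrtr costPQ))// weighted_minkowski.
Qed.

(** * Separation of inequivalent clouds *)

Lemma rw_cost_eq0_support (R : realType) (n : nat) (P Q : wcloud R n) x :
  rw_feasible P Q x -> rw_cost x.1 x.2 = 0 ->
  forall i j, x.2 i j != 0 -> wpoint P i *m x.1 = wpoint Q j.
Proof.
move=> [_ [_ _ s0]] cost0 i j sij.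
have term_ge0 i' j' :
    0 <= x.2 i' j' * norm2 (wpoint P i' *m x.1 - wpoint Q j') ^+ 2.
  by rewrite mulr_ge0 ?sqr_ge0.
move/eqP: cost0; rewrite /rw_cost psumr_eq0 => [/allP|? _]; last exact: sumr_ge0.
move=> /(_ i (mem_index_enum _)); rewrite psumr_eq0// => /allP.
move=> /(_ j (mem_index_enum _)); rewrite mulf_eq0 (negPf sij) /= => /eqP d0.
by apply/eqP; rewrite -subr_eq0; apply/eqP/norm2_sqr_eq0.
Qed.

Lemma sum_neq0_exists (R : realType) (I : finType) (F : I -> R) :
  \sum_i F i != 0 -> exists i, F i != 0.
Proof.
move=> /eqP sF; apply: contrapT => noF; apply: sF; apply: big1 => i _.
by apply/eqP; apply: contrapT => /negP Fi; apply: noF; exists i.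
Qed.

(** In a plan of cost zero each source point sends mass to a single target,
    as targets are distinct, and each target receives it from a single source,
    as the images of the sources are distinct.  The entry of the plan at (i, f i) is then
    alone in its row and in its column, so it equals both masses. *)
Lemma rw_cost_eq0_map (R : realType) (n : nat) (P Q : wcloud R n) x :
  rw_feasible P Q x -> rw_cost x.1 x.2 = 0 ->
  exists2 f : 'I_(wsize P) -> 'I_(wsize Q), injective f &
    forall i, wpoint P i *m x.1 = wpoint Q (f i) /\ wmass P i = wmass Q (f i).
Proof.
move=> xF cost0; have support := rw_cost_eq0_support xF cost0.
case: xF => AO [sP sQ _].
have /choice[f sf] i : exists j, x.2 i j != 0.
  by apply: sum_neq0_exists; rewrite sP gt_eqF// wmass_gt0.
have fE i : wpoint P i *m x.1 = wpoint Q (f i) by exact: support.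
have sfun i j : j != f i -> x.2 i j = 0.
  move=> jfi; apply/eqP; apply: contraNT jfi => /support.
  by rewrite fE => /wpoint_inj ->.
have f_inj : injective f.
  by move=> i i' ff; apply/(@wpoint_inj _ _ P)/(mulmx_orthogonal_inj AO); rewrite !fE ff.
exists f => // i; split; first exact: fE.
rewrite -sP -sQ (bigD1 (f i))//= (bigD1 (R := R) i)//= !big1// => [i' ii'|j].
  by apply: sfun; rewrite (inj_eq f_inj) eq_sym.
exact: sfun.
Qed.

(** A zero-cost plan and its transpose give injections both ways between the
    index sets, hence clouds of the same size, and the first injection is a
    permutation. *)
Lemma RWD_eq0_wequiv (R : realType) (n : nat) (P Q : wcloud R n) :
  RWD P Q = 0 -> wequiv P Q.
Proof.
have [x xF ->] := RWD_attained P Q => /eqP; rewrite sqrtr_eq0 => cost_le0.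
have cost0 : rw_cost x.1 x.2 = 0.
  by apply/eqP; rewrite eq_le cost_le0 rw_cost_ge0.
have [f f_inj fE] := rw_cost_eq0_map xF cost0.
have [g g_inj _] : exists2 g : 'I_(wsize Q) -> 'I_(wsize P), injective g &
    forall j, wpoint Q j *m x.1^T = wpoint P (g j) /\ wmass Q j = wmass P (g j).
  by apply: (rw_cost_eq0_map (rw_feasibleT xF)); rewrite (rw_costT _ xF.1).
have e : wsize P = wsize Q.
  apply/eqP; rewrite eqn_leq.
  by have := leq_card _ f_inj; have := leq_card _ g_inj; rewrite !card_ord => -> ->.
have fe_inj : injective (fun i => cast_ord (esym e) (f i)).
  by move=> i i' /cast_ord_inj/f_inj.
exists e, x.1, (perm fe_inj); split; first exact: xF.1.
by move=> i; rewrite permE cast_ordKV.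
Qed.

(** The plan supported on the graph of the given permutation costs nothing. *)
Lemma wequiv_RWD_eq0 (R : realType) (n : nat) (P Q : wcloud R n) :
  wequiv P Q -> RWD P Q = 0.
Proof.
move=> [e [A [pi [AO PQ]]]].
pose s := \matrix_(i, j) (wmass P i *+ (cast_ord e (pi i) == j)) :
  'M[R]_(wsize P, wsize Q).
have sF : rw_feasible P Q (A, s).
  split=> //=; split=> [i|j|i j]; last by rewrite mxE mulrn_wge0// wmass_ge0.
    under eq_bigr do rewrite mxE.
    rewrite (bigD1 (cast_ord e (pi i)))//= eqxx big1 ?addr0// => j.
    by rewrite eq_sym => /negPf ->.
  under eq_bigr do rewrite mxE.
  pose i := (pi^-1)%g (cast_ord (esym e) j).
  have piE : cast_ord e (pi i) = j by rewrite permKV cast_ordKV.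
  rewrite (bigD1 i)//= piE eqxx big1 ?addr0 => [|i' ii'].
    by rewrite (PQ i).2 piE.
  by rewrite -piE (inj_eq (@cast_ord_inj _ _ e)) (inj_eq perm_inj) (negPf ii').
apply/eqP; rewrite eq_le RWD_ge0 andbT (le_trans (RWD_le sF))//=.
rewrite /rw_cost big1 ?sqrtr0// => i _; rewrite big1// => j _; rewrite mxE.
have [<-|] := eqVneq; last by rewrite mulr0n mul0r.
by rewrite (PQ i).1 subrr norm20 expr0n mulr0.
Qed.

Lemma RWD_eq0 (R : realType) (n : nat) (P Q : wcloud R n) :
  RWD P Q = 0 <-> wequiv P Q.
Proof. by split; [exact: RWD_eq0_wequiv|exact: wequiv_RWD_eq0]. Qed.

(** * Descent to the quotient *)

(** A pseudometric is unchanged when its arguments move by distance zero. *)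
Lemma RWD_wequiv (R : realType) (n : nat) (P Q P' Q' : wcloud R n) :
  wequiv P P' -> wequiv Q Q' -> RWD P Q = RWD P' Q'.
Proof.
suff le (X Y X' Y' : wcloud R n) : wequiv X X' -> wequiv Y Y' -> RWD X' Y' <= RWD X Y.
  by move=> PP' QQ'; apply/eqP; rewrite eq_le !le//; exact: wequiv_sym.
move=> /wequiv_sym/wequiv_RWD_eq0 XX' /wequiv_RWD_eq0 YY'.
rewrite (le_trans (RWD_triangle _ _ X))// XX' add0r.
by rewrite (le_trans (RWD_triangle _ _ Y))// YY' addr0.
Qed.

Lemma wequiv_repr (R : realType) (n : nat) (P : wcloud R n) :
  wequiv P (repr (\pi_(wcloud_quot R n) P)).
Proof.
apply/asboolP; apply/(@eqmodP _ (wequiv_rel R n)).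
by rewrite reprK.
Qed.

Theorem theorem1 (R : realType) (n : nat) (hn : (1 <= n)%N) :
  (forall P Q : wcloud R n,
    (exists x : 'M[R]_n * 'M[R]_(wsize P, wsize Q), rw_solution P Q x) /\
    (forall P' Q' : wcloud R n,
       wequiv P P' -> wequiv Q Q' -> RWD P Q = RWD P' Q') /\
    (0 <= RWD P Q /\ (RWD P Q = 0 <-> wequiv P Q)) /\
    RWD P Q = RWD Q P /\
    (forall S : wcloud R n, RWD P Q <= RWD P S + RWD S Q)) /\
  (exists d : wcloud_quot R n -> wcloud_quot R n -> R,
     (forall P Q : wcloud R n,
        d (\pi_(wcloud_quot R n) P) (\pi_(wcloud_quot R n) Q) = RWD P Q) /\
     is_distance d).
Proof.
split=> [P Q|].
  split; first exact: rw_solution_exists.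
  split; first by move=> P' Q'; exact: RWD_wequiv.
  split; first by split; [exact: RWD_ge0|exact: RWD_eq0].
  by split; [exact: RWD_sym|move=> S; exact: RWD_triangle].
exists (fun x y => RWD (repr x) (repr y)); split=> [P Q|].
  by apply/esym/RWD_wequiv; exact: wequiv_repr.
split=> [x y|x y|x y|x y z].
- exact: RWD_ge0.
- rewrite RWD_eq0; split=> [xy|->]; last exact: wequiv_refl.
  rewrite -[x]reprK -[y]reprK; apply/(@eqmodP _ (wequiv_rel R n)).
  exact/asboolP.
- exact: RWD_sym.
- exact: RWD_triangle.
Qed.
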